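(* For every integer $k\geq 1$, let $g(k)$ denote the minimum integer $d$ such that every triangle-free graph of minimum degree at least $d$ contains $k$ pairwise vertex-disjoint cycles whose lengths are pairwise different. Then (a) $g(k)$ exists, and (b) $g(k)=\dfrac{k(k+3)}{2}$.
   Context: All graphs are finite and simple. The length of a cycle is its number of vertices. *)

(* Defs.v *)
From mathcomp Require Import all_boot.

Set Implicit Arguments.
Unset Strict Implicit.
Unset Printing Implicit Defensive.

Record sgraph := SGraph {
  vertex :> finType;
  adj : rel vertex;
  adj_sym : symmetric adj;
  adj_irrefl : irreflexive adj
}.

Definition degree (G : sgraph) (v : G) : nat := #|[set w | adj v w]|.

(* Every degree is less than #|G|, so the default #|G| only matters for the
   graph without vertices, whose minimum degree is then 0.  In particular that
   graph does not vacuously have a large minimum degree. *)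
Definition min_degree (G : sgraph) : nat := \big[minn/#|G|]_(v : G) degree v.

Definition triangle_free (G : sgraph) : Prop :=
  forall x y z : G, ~ [/\ adj x y, adj y z & adj z x].

(* A cycle is given by its vertices listed in cyclic order.  MathComp's [ucycle]
   also accepts lists of size 0 and 2 (an edge traversed back and forth), hence
   the lower bound on the size. *)
Definition is_cycle (G : sgraph) (c : seq G) : Prop :=
  2 < size c /\ ucycle (@adj G) c.

Definition has_disjoint_cycles_of_distinct_lengths (G : sgraph) (k : nat) : Prop :=
  exists c : 'I_k -> seq G,
    (forall i, is_cycle (c i)) /\
    (forall i j, i != j ->
       [disjoint c i & c j] /\ size (c i) <> size (c j)).

Definition degree_forces (k d : nat) : Prop :=
  forall G : sgraph, triangle_free G -> d <= min_degree G ->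
    has_disjoint_cycles_of_distinct_lengths G k.

(* [is_g k d] says that the minimum defining g(k) is attained and equals d. *)
Definition is_g (k d : nat) : Prop :=
  degree_forces k d /\ (forall d', degree_forces k d' -> d <= d').

(* Main.v *)
Require Import Defs.
From mathcomp Require Import all_boot.
From mathcomp Require Import zify.

Set Implicit Arguments.
Unset Strict Implicit.
Unset Printing Implicit Defensive.

(** Upper bound, by induction on [k].  Among the paths [x :: p] with [k + 1]
    neighbours of [x] on [p], take a shortest one.  Closing initial segments of
    this path at the neighbours of [x] gives cycles of [k] different lengths.  A
    vertex [v] outside the path has at most [k + 1] neighbours on it: otherwise
    the piece of the path that starts at the first neighbour of [v] and omits
    the last two vertices, at most one of which is adjacent to [v] because there is
    no triangle, gives a shorter path of the same kind from [v].  Deleting the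
    path lowers degrees by at most [k + 1 = g(k) - g(k - 1)]; the [k - 1] cycles
    found in the rest use [k - 1] lengths, so one of the [k] lengths is free.

    Lower bound: cycles in a complete bipartite graph have even length, hence
    [k] disjoint ones of different lengths cover at least
    [4 + 6 + ... + 2 (k + 1) = k (k + 3)] vertices. *)

(** * Minimum degree and the increments of [k * (k + 3) / 2] *)

Lemma leq_bigmin (I : Type) (r : seq I) (F : I -> nat) (m n : nat) :
  (m <= \big[minn/n]_(i <- r) F i) = (m <= n) && all (fun i => m <= F i) r.
Proof.
elim: r => [|i r IH]; first by rewrite big_nil andbT.
by rewrite big_cons leq_min IH /= andbCA.
Qed.

Lemma leq_min_degree (G : sgraph) (d : nat) :
  (d <= min_degree G) = (d <= #|G|) && [forall v : G, d <= degree v].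
Proof.
rewrite /min_degree leq_bigmin; congr (_ && _).
apply/allP/forallP => [H v|H v _]; last exact: H.
exact: H (mem_index_enum v).
Qed.

Lemma half_mul_add3S (k : nat) :
  (k.+1 * (k.+1 + 3)) %/ 2 = (k * (k + 3)) %/ 2 + k.+2.
Proof.
rewrite (_ : k.+1 * _ = k.+2 * 2 + k * (k + 3)); last by nia.
by rewrite divnMDl // addnC.
Qed.

(** * Paths containing many neighbours of their first vertex *)

(** Confining the path to a set [A] lets the induction delete vertices while the graph stays
    fixed. *)
Definition fan (G : sgraph) (A : {set G}) (n : nat) (x : G) (p : seq G) : Prop :=
  [/\ path (@adj G) x p, uniq (x :: p), {subset x :: p <= A}
    & n <= count (adj x) p].

(** A path in [A] is extended at its front until stuck; then all neighbours of [x] in [A] lie on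
    [p]. *)
Lemma fan_exists (G : sgraph) (A : {set G}) (n : nat) :
  A != set0 -> {in A, forall v, n <= #|[set w in A | adj v w]|} ->
  exists x p, fan A n x p.
Proof.
move=> /set0Pn[x0 x0A] degA.
have extend m x p : #|G| <= size p + m -> path (@adj G) x p -> uniq (x :: p) ->
    {subset x :: p <= A} -> exists x p, fan A n x p.
  elim: m x p => [|m IH] x p lem pP pU pA.
    have := max_card (mem (x :: p)); rewrite (card_uniqP pU) /=.
    move: lem; rewrite addn0 leqNgt => /negP H /H [].
  have [/existsP[y /and3P[yA yp xy]]|/existsPn N] :=
    boolP [exists y, [&& y \in A, y \notin x :: p & adj x y]].
    apply: (IH y (x :: p)).
    - by rewrite addSnnS.
    - by rewrite /= adj_sym xy.
    - by rewrite cons_uniq yp.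
    - by move=> z; rewrite inE => /predU1P[->|/pA].
  exists x, p; split=> //.
  apply: leq_trans (degA x (pA x (mem_head _ _))) _.
  rewrite -size_filter; apply: leq_trans (card_size _).
  apply/subset_leq_card/subsetP => y; rewrite inE mem_filter => /andP[yA xy].
  have:= N y; rewrite yA xy andbT /= negbK inE => /predU1P[yx|//].
  by rewrite yx adj_irrefl in xy.
apply: (extend #|G| x0 [::]) => //=.
by move=> y; rewrite inE => /eqP->.
Qed.

Lemma fan_shorten (G : sgraph) (A : {set G}) (n : nat) (x v : G) (p : seq G) :
  triangle_free G -> 1 < n -> fan A n x p -> v \in A -> v \notin x :: p ->
  n < count (adj v) (x :: p) ->
  exists2 q, fan A n v q & size q < size p.
Proof.
move=> tf n1 [pP pU pA _] vA vp nv.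
have hv : has (adj v) (x :: p) by rewrite has_count; lia.
have [y [s1 [s2 [es vy s1v]]]] : exists y s1 s2,
    [/\ x :: p = s1 ++ y :: s2, adj v y & count (adj v) s1 = 0].
  case/split_find: hv => y s1 s2 vy ns1; exists y, s1, s2.
  by rewrite cat_rcons; split=> //; apply/eqP; rewrite -leqn0 leqNgt -has_count.
move: nv; rewrite es count_cat s1v add0n => nv.
(* [v] has at least three neighbours in [y :: s2], so at least two vertices follow [y]. *)
case/lastP: s2 => [|s2 z] in es nv *; first by move: nv; rewrite /= vy; lia.
case/lastP: s2 => [|s3 z'] in es nv *.
  by move: nv; rewrite /= vy; case: (adj v z); lia.
have sP : sorted (@adj G) (x :: p) by [].
have inf : infix (y :: s3) (x :: p).
  by apply/infixP; exists s1, [:: z'; z]; rewrite es -!cats1 /= -catA.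
have zz : adj z' z.
  have: infix [:: z'; z] (x :: p).
    by apply/infixP; exists (s1 ++ y :: s3), [::]; rewrite es -!cats1 /= -!catA.
  by move/(@infix_sorted _ (@adj G)) => /(_ sP) /= /andP[].
have nvz : adj v z' + adj v z <= 1.
  case vz': (adj v z'); case vz: (adj v z) => //.
  by case: (tf v z' z); rewrite vz' zz adj_sym vz.
(* As [v] is added in front, removing two vertices makes the path shorter even when [s1] is
   empty. *)
exists (y :: s3); last first.
  by have /(congr1 size) := es; rewrite size_cat /= !size_rcons /=; lia.
split.
- by rewrite /= vy; apply: (infix_sorted inf sP).
- rewrite cons_uniq (subseq_uniq (infixW inf) pU) andbT.
  by apply: contra vp; apply: mem_subseq (infixW inf) _.
- move=> w; rewrite inE => /predU1P[->//|].
  by move/(mem_subseq (infixW inf))/pA.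
- by move: nv; rewrite -!cats1 /= !count_cat /=; lia.
Qed.

Lemma tight_fan_exists (G : sgraph) (A : {set G}) (n : nat) :
  triangle_free G -> 1 < n -> A != set0 ->
  {in A, forall v, n <= #|[set w in A | adj v w]|} ->
  exists x p, [/\ fan A n x p, count (adj x) p = n
    & {in A, forall v, v \notin x :: p -> count (adj v) (x :: p) <= n}].
Proof.
move=> tf n1 A0 degA; have [x [p]] := fan_exists A0 degA.
have [m] := ubnP (size p); elim: m x p => // m IH x p lem F.
have [pP pU pA np] := F.
have [cn|] := eqVneq (count (adj x) p) n; last first.
  case/lastP: p => [|p z] in lem F pP pU pA np *; first by move: np => /=; lia.
  move=> cn; apply: (IH x p); first by move: lem; rewrite size_rcons; lia.
  split.
  - by move: pP; rewrite rcons_path => /andP[].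
  - by move: pU; rewrite -rcons_cons rcons_uniq => /andP[].
  - by move=> w wp; apply: pA; rewrite -rcons_cons mem_rcons inE wp orbT.
  - by move: np cn; rewrite -cats1 count_cat /=; case: (adj x z); lia.
have [/existsP[v /and3P[vA vp nv]]|/existsPn N] :=
  boolP [exists v, [&& v \in A, v \notin x :: p & n < count (adj v) (x :: p)]].
  have [q Fq qp] := fan_shorten tf n1 F vA vp nv.
  by apply: (IH v q) => //; lia.
exists x, p; split=> // v vA vp.
by have:= N v; rewrite vA vp /= -leqNgt.
Qed.

(** * Disjoint cycles of different lengths: the upper bound *)

(** Every neighbour of [x] on [p] except the first closes a cycle, hence the offset in the count. If
    the longest such length is in [S], it is removed from [S] and [p] loses its last vertex; the
    bound on [size c] ensures that the removed length does not return. *)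
Lemma fan_cycle (G : sgraph) (x : G) (p : seq G) (S : seq nat) :
  path (@adj G) x p -> uniq (x :: p) -> (size S).+1 < count (adj x) p ->
  exists c, [/\ is_cycle c, {subset c <= x :: p}, size c <= (size p).+1
    & size c \notin S].
Proof.
elim/last_ind: p S => [|p z IH] S //.
rewrite rcons_path -rcons_cons rcons_uniq => /andP[pP pz] /andP[zp pU].
rewrite -cats1 count_cat /= cats1 addn0 size_rcons => cS.
have sub c : {subset c <= x :: p} -> {subset c <= rcons (x :: p) z}.
  by move=> H w /H wp; rewrite mem_rcons inE wp orbT.
have [xz|nxz] := boolP (adj x z); last first.
  rewrite (negbTE nxz) addn0 in cS.
  have [c [cc cp sc cS']] := IH S pP pU cS.
  by exists c; split=> //; [exact: sub | lia].
have [Sin|nS] := boolP ((size p).+2 \in S).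
  have [|c [cc cp sc cS']] := IH (rem (size p).+2 S) pP pU.
    rewrite size_rem // prednK; last by case: (S) Sin.
    by move: cS; rewrite xz addn1.
  exists c; split=> //; [exact: sub | by lia |].
  apply: contra cS' => cin.
  move: cin; rewrite (perm_mem (perm_to_rem Sin)) inE => /predU1P[e|//].
  by move: sc; rewrite e ltnn.
exists (rcons (x :: p) z); split=> //; last by rewrite size_rcons.
  split.
    (* Another neighbour of [x] precedes [z], so the cycle has at least three vertices. *)
    rewrite size_rcons /= ltnS ltnS; apply: leq_trans (count_size (adj x) p).
    by move: cS; rewrite xz addn1 ltnS; apply: leq_ltn_trans.
  rewrite /ucycle rcons_uniq zp pU !andbT /= !rcons_path last_rcons pP pz.
  by rewrite adj_sym.
by rewrite size_rcons.
Qed.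

(** For empty [A] the degree condition is vacuous, so nonemptiness is required separately; for
    [k = 0] the path may have used up all vertices. *)
Lemma disjoint_cycles_within (G : sgraph) (k : nat) (A : {set G}) :
  triangle_free G -> (0 < k -> A != set0) ->
  {in A, forall v, (k * (k + 3)) %/ 2 <= #|[set w in A | adj v w]|} ->
  exists cs : seq (seq G),
    [/\ size cs = k, {in cs, forall c, is_cycle c /\ {subset c <= A}},
      uniq (map size cs)
      & pairwise (fun c c' : seq G => [disjoint c & c']) cs].
Proof.
move=> tf; elim: k A => [|k IH] A A0 degA; first by exists [::].
rewrite half_mul_add3S in degA.
have [|x [p [[pP pU pA _] cp outp]]] := tight_fan_exists (n := k.+2) tf isT (A0 isT).
  by move=> v /degA; apply: leq_trans; rewrite leq_addl.
pose B := A :\: [set w in x :: p].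
have degB v : v \in A ->
    (k * (k + 3)) %/ 2 + k.+2 <=
      #|[set w in B | adj v w]| + count (adj v) (x :: p).
  move=> /degA H; apply: leq_trans H _; rewrite -size_filter.
  apply: leq_trans (leq_add (leqnn _) (card_size _)); rewrite -[X in _ + X]cardsE.
  apply: leq_trans (leq_of_leqif (leq_card_setU _ _)).
  apply/subset_leq_card/subsetP => w; rewrite !in_set mem_filter.
  by move=> /andP[-> ->]; rewrite !andbT orNb.
have [||cs [scs ccs ucs dcs]] := IH B.
(* [x] has exactly [k.+2] neighbours on the path and, for positive [k], more than that in [A]; so
   one lies in [B]. *)
- move=> k0; have := degB x (pA x (mem_head _ _)).
  rewrite /= adj_irrefl cp leq_add2r => H.
  have: 0 < #|[set w in B | adj x w]| by apply: leq_trans H; rewrite divn_gt0 //; nia.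
  by rewrite card_gt0 => /set0Pn[w]; rewrite inE => /andP[wB _]; apply/set0Pn; exists w.
- move=> v; rewrite inE => /andP[]; rewrite inE => vp vA.
  rewrite -(leq_add2r k.+2); apply: leq_trans (degB v vA) _.
  rewrite leq_add2l; apply: outp => //; by move: vp; rewrite inE.
have [|c [cc cp' _ cS]] := fan_cycle (S := map size cs) pP pU.
  by rewrite size_map scs cp.
exists (c :: cs); split=> /=.
- by rewrite scs.
- move=> d; rewrite inE => /predU1P[->|/ccs[dc dB]]; split=> //.
    by move=> w /cp' /pA.
  by move=> w /dB; rewrite inE => /andP[].
- by rewrite cS.
- rewrite dcs andbT; apply/allP => d /ccs[_ dB].
  rewrite disjoint_subset; apply/subsetP => w /cp' wp.
  by rewrite inE; apply/negP => /dB; rewrite !in_set wp.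
Qed.

Lemma degree_forces_half_mul_add3 (k : nat) : degree_forces k ((k * (k + 3)) %/ 2).
Proof.
move=> G tf; rewrite leq_min_degree => /andP[dG /forallP degG].
have [||cs [scs ccs ucs dcs]] := @disjoint_cycles_within G k [set: G] tf.
(* The conjunct [d <= #|G|] of the minimum degree bound excludes the graph without vertices. *)
- case: k dG {degG} => // k; rewrite half_mul_add3S => dG _.
  by rewrite -card_gt0 cardsT; lia.
- move=> v _; apply: leq_trans (degG v) _.
  by apply/subset_leq_card/subsetP => w; rewrite !inE.
exists (fun i => nth [::] cs i); split=> [i|i j ij].
  by have [] := ccs (nth [::] cs i) (mem_nth _ _); rewrite ?scs.
have lts (l : 'I_k) : l < size cs by rewrite scs.
split.
  wlog ij' : i j ij / i < j => [H|].
    have [/H|/H|/val_inj e] := ltngtP i j; first exact.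
      by rewrite disjoint_sym eq_sym; apply.
    by rewrite e eqxx in ij.
  by move/(pairwiseP [::]): dcs; apply; rewrite ?inE.
move=> e; case/negP: ij; apply/eqP/val_inj/eqP => /=.
by rewrite -(nth_uniq 0 _ _ ucs) ?size_map // !(nth_map [::]) // e.
Qed.

(** * Complete bipartite graphs: the lower bound *)

(** The entries are at least [a + 1], [a + 2], and so on; both sides are doubled to avoid
    division. *)
Lemma path_ltn_sumn (a : nat) (s : seq nat) :
  path ltn a s -> size s * (size s + a.*2.+1) <= (sumn s).*2.
Proof.
by elim: s a => //= x s IH a /andP[ax /IH]; nia.
Qed.

Lemma sumn_uniq_geq2 (s : seq nat) :
  uniq s -> all (leq 2) s -> (size s * (size s + 3)) %/ 2 <= sumn s.
Proof.
move=> us as2.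
have := @path_ltn_sumn 1 (sort leq s).
rewrite size_sort (perm_sumn (permEl (perm_sort _ _))) path_sortedE; last exact: ltn_trans.
rewrite all_sort as2 ltn_sorted_uniq_leq sort_uniq us (sort_sorted leq_total).
by move=> /(_ isT); lia.
Qed.

Definition bip_adj (m : nat) : rel (bool * 'I_m) := fun u v => u.1 != v.1.

Lemma bip_adj_sym (m : nat) : symmetric (@bip_adj m).
Proof. by move=> u v; rewrite /bip_adj eq_sym. Qed.

Lemma bip_adj_irrefl (m : nat) : irreflexive (@bip_adj m).
Proof. by move=> u; rewrite /bip_adj eqxx. Qed.

Definition complete_bipartite (m : nat) : sgraph :=
  SGraph (@bip_adj_sym m) (@bip_adj_irrefl m).

Lemma complete_bipartite_triangle_free (m : nat) :
  triangle_free (complete_bipartite m).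
Proof. by move=> [[] x] [[] y] [[] z] []. Qed.

Lemma leq_min_degree_complete_bipartite (m : nat) :
  m <= min_degree (complete_bipartite m).
Proof.
have card_G : #|complete_bipartite m| = 2 * m.
  by rewrite card_prod card_bool card_ord.
rewrite leq_min_degree card_G; apply/andP; split; first by lia.
apply/forallP => -[b i]; rewrite /degree -[X in X <= _](card_ord m).
rewrite -(card_imset _ (f := fun j : 'I_m => (~~ b, j))); last by move=> j j' [].
by apply/subset_leq_card/subsetP => _ /imsetP[j _ ->]; rewrite inE /=; case: (b).
Qed.

Lemma complete_bipartite_cycle_even (m : nat) (c : seq (complete_bipartite m)) :
  is_cycle c -> ~~ odd (size c).
Proof.
(* Each edge changes sides, so the side of the last vertex records the parity of the length. *)
have alt x p : path (@adj (complete_bipartite m)) x p ->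
    (last x p).1 = x.1 (+) odd (size p).
  elim: p x => [|y p IH] x /=; first by rewrite addbF.
  move=> /andP[xy /IH ->]; move: xy; rewrite /bip_adj /=.
  by case: (x.1) (y.1) (odd _) => [] [] [].
case: c => [[]//|x p [_ /andP[/alt]]].
by rewrite last_rcons size_rcons /=; case: (x.1) (odd _) => [] [].
Qed.

Lemma sum_size_disjoint (T : finType) (k : nat) (c : 'I_k -> seq T) :
  (forall i, uniq (c i)) -> (forall i j, i != j -> [disjoint c i & c j]) ->
  \sum_(i < k) size (c i) <= #|T|.
Proof.
move=> uc dc.
apply: leq_trans (max_card (mem (\bigcup_i [set x in c i]))).
rewrite -sum1_card partition_disjoint_bigcup => [|i j /dc].
  by apply: leq_sum => i _; rewrite sum1_card cardsE (card_uniqP (uc i)).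
rewrite !disjoint_subset => /subsetP H.
by apply/subsetP => x; rewrite inE => /H; rewrite !inE.
Qed.

Lemma half_mul_add3_leq (k d : nat) : degree_forces k d -> (k * (k + 3)) %/ 2 <= d.
Proof.
move=> /(_ _ (@complete_bipartite_triangle_free d)).
move=> /(_ (leq_min_degree_complete_bipartite d)) [c [cyc dis]].
have ucyc i : uniq (c i) by have [_ /andP[]] := cyc i.
have := sum_size_disjoint ucyc (fun i j ij => (dis i j ij).1).
have -> : \sum_(i < k) size (c i) = (\sum_(i < k) (size (c i))./2).*2.
  rewrite -mul2n big_distrr; apply: eq_bigr => i _ /=.
  by rewrite mul2n even_halfK //; apply: complete_bipartite_cycle_even.
(* Even cycles have length at least 4, so the half-lengths are distinct and at least 2; their sum is
   at most [d], as the graph has [2 * d] vertices. *)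
pose s := [seq (size (c i))./2 | i <- enum 'I_k].
have -> : \sum_(i < k) (size (c i))./2 = sumn s by rewrite sumnE big_map big_enum.
have := @sumn_uniq_geq2 s.
rewrite size_map size_enum_ord card_prod card_bool card_ord => H.
suff [us as2] : uniq s /\ all (leq 2) s by have := H us as2; lia.
split.
  rewrite map_inj_uniq ?enum_uniq // => i j e; apply/eqP.
  apply: contraT => /dis[_ []].
  rewrite -(even_halfK (complete_bipartite_cycle_even (cyc i))).
  by rewrite -(even_halfK (complete_bipartite_cycle_even (cyc j))) e.
apply/allP => _ /mapP[i _ ->]; have [] := cyc i.
by have := complete_bipartite_cycle_even (cyc i); lia.
Qed.

Theorem theorem2p13 (k : nat) (hk : 1 <= k) :
  (exists d : nat, is_g k d) /\
  (forall d : nat, is_g k d -> d = (k * (k + 3)) %/ 2).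
Proof.
split=> [|d [fd mind]].
  exists ((k * (k + 3)) %/ 2); split; first exact: degree_forces_half_mul_add3.
  exact: half_mul_add3_leq.
apply/eqP; rewrite eqn_leq half_mul_add3_leq // andbT.
exact/mind/degree_forces_half_mul_add3.
Qed.
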